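(* Let $a,b$ be integers with $0\le b\le a$. Then the generating function $\sum_{n=0}^{\infty}\beta_n(a,b)\,q^n$ of the sequence $(\beta_n(a,b))_{n\ge 0}$ is a rational function of $q$ with linearly factored denominator of the form $$\prod_{\substack{i_1<i_2<\dots<i_b\\ i_1,i_2,\dots,i_b\in\{1,2,\dots,a\}}}\left(1-\frac{a!}{i_1i_2\cdots i_b}\,q\right);$$ that is, there is a polynomial $P(q)$ (depending on $a$ and $b$) such that, as formal power series in $q$, $\sum_{n=0}^{\infty}\beta_n(a,b)\,q^n$ equals $P(q)$ divided by this product.
   Context: For non-negative integers $m,k$, $\left[{m\atop k}\right]$ denotes the unsigned Stirling number of the first kind, i.e. the number of permutations of $m$ elements with exactly $k$ disjoint cycles; equivalently $x(x+1)\cdots(x+m-1)=\sum_{k=0}^m\left[{m\atop k}\right]x^k$, and $\left[{m\atop k}\right]=0$ for $k>m$. For non-negative integers $a,b,n$ define $$\beta_n(a,b)=\det\left(\left[{i+a\atop j+b}\right]\right)_{1\le i,j\le n},$$ with the convention that the empty determinant is $1$, so $\beta_0(a,b)=1$. When $b=0$ the product over $b$-tuples has a single factor (the empty tuple, with empty product $i_1\cdots i_b=1$), namely $1-a!\,q$. The fraction is not required to be in lowest terms. *)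

(* Defs.v *)
From mathcomp Require Import all_boot all_order all_fingroup all_algebra.

Set Implicit Arguments.
Unset Strict Implicit.
Unset Printing Implicit Defensive.

Import GRing.Theory.
Local Open Scope ring_scope.

Definition stirling1 (m k : nat) : nat :=
  #|[set s : 'S_m | #|porbits s| == k]|.

(* Ordinals start at 0 while the rows and columns are numbered 1..n, hence
   the successors.  For n = 0 this is the empty determinant, which is 1. *)
Definition beta (a b n : nat) : int :=
  \det (\matrix_(i < n, j < n) (stirling1 (i.+1 + a)%N (j.+1 + b)%N)%:Z).

(* A formal power series over R is its sequence of coefficients. *)
Definition fps (R : Type) : Type := nat -> R.

Definition fps_of_poly (R : nzSemiRingType) (p : {poly R}) : fps R :=
  fun n => p`_n.

Definition fps_mul (R : nzSemiRingType) (f g : fps R) : fps R :=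
  fun n => \sum_(i < n.+1) f i * g (n - i)%N.

(* A power series over a field is invertible iff its constant coefficient is
   nonzero, so f is then the unique series with f * D = P. *)
Definition fps_is_quotient (F : fieldType) (f : fps F) (P D : {poly F}) : Prop :=
  D`_0 != 0 /\ fps_mul f (fps_of_poly D) =1 fps_of_poly P.

Definition beta_gf (a b : nat) : fps rat := fun n => (beta a b n)%:~R.

(* A tuple i_1 < ... < i_b in {1, ..., a} is encoded as the b-element set I of
   the ordinals i_k - 1 in 'I_a. *)
Definition beta_den (a b : nat) : {poly rat} :=
  \prod_(I : {set 'I_a} | #|I| == b)
     (1 - ((a`!)%:R / \prod_(i in I) (i.+1)%:R) *: 'X).

(* Main.v *)
(** The polynomials [f_m = prod_(1 <= t <= m) (X + t)] have the coefficients
    [stirling1 m.+1 k.+1], so [beta a b n] is the window of columns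
    b, ..., b + n - 1 in the coefficient matrix of [f_a, ..., f_(a+n-1)].  These
    polynomials vanish at -1, ..., -a; a Jacobi-type complementary minor argument
    turns the window into the generalized Vandermonde determinant at these points
    with the exponents 0, ..., b - 1, b + n, ..., a + n - 1.  In its expansion over
    permutations s of the points, n only enters through the n-th power of the
    product of the points that s does not assign to the first b exponents.  Hence
    [beta a b n] is a combination, with coefficients independent of n, of the
    n-th powers of [a! / (i_1 ... i_b)]. *)

Require Import Defs.
From mathcomp Require Import all_boot all_order all_fingroup all_algebra.
From mathcomp Require Import zify ring.

Import GRing.Theory Num.Theory.
Local Open Scope ring_scope.

(** * Cycle counts of permutations and rising factorials *)

Lemma lift_permX {m} (i : 'I_m.+1) (s : 'S_m) k x :
  (lift_perm i i s ^+ k)%g (lift i x) = lift i ((s ^+ k)%g x).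
Proof.
elim: k x => [|k IHk] x; first by rewrite !expg0 !perm1.
by rewrite !expgS !permM lift_perm_lift IHk.
Qed.

Lemma lift_permX_id {m} (i : 'I_m.+1) (s : 'S_m) k :
  (lift_perm i i s ^+ k)%g i = i.
Proof.
elim: k => [|k IHk]; first by rewrite expg0 perm1.
by rewrite expgS permM lift_perm_id.
Qed.

Lemma porbit_lift_perm_id {m} (i : 'I_m.+1) (s : 'S_m) :
  porbit (lift_perm i i s) i = [set i].
Proof.
apply/setP => x; rewrite inE.
apply/porbitP/eqP => [[k ->]|->]; first by rewrite lift_permX_id.
by exists 0%N; rewrite expg0 perm1.
Qed.

Lemma porbit_lift_perm_lift {m} (i : 'I_m.+1) (s : 'S_m) x :
  porbit (lift_perm i i s) (lift i x) = lift i @: porbit s x.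
Proof.
apply/setP => y; apply/porbitP/imsetP => [[k ->]|[_ /porbitP[k ->] ->]].
  by exists ((s ^+ k)%g x); rewrite ?mem_porbit ?lift_permX.
by exists k; rewrite lift_permX.
Qed.

(** The fixed point [i] forms an orbit of its own; the others are the images of the orbits of [s]
    under [lift i], which misses [i]. *)
Lemma card_porbits_lift_perm {m} (i : 'I_m.+1) (s : 'S_m) :
  #|porbits (lift_perm i i s)| = #|porbits s|.+1.
Proof.
set P := [set lift i @: (A : {set 'I_m}) | A in porbits s].
have -> : porbits (lift_perm i i s) = [set i] |: P.
  apply/setP => A; apply/imsetP/setU1P =>
    [[x _ ->]|[->|/imsetP[_ /imsetP[x _ ->] ->]]].
  - case: (unliftP i x) => [y|] ->; last by left; apply: porbit_lift_perm_id.
    by right; rewrite porbit_lift_perm_lift; do 2 apply: imset_f.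
  - by exists i => //; rewrite porbit_lift_perm_id.
  - by exists (lift i x) => //; rewrite porbit_lift_perm_lift.
rewrite cardsU1 card_imset; last by apply: imset_inj; apply: lift_inj.
case: imsetP => // -[A _ /setP/(_ i)]; rewrite !inE eqxx => /esym/imsetP[x _].
by move/eqP; rewrite (negPf (neq_lift i x)).
Qed.

(* Every permutation of m.+1 points is uniquely [t * s] with [s] fixing 0 and
   [t] either trivial or a transposition moving 0, which merges two cycles. *)
Lemma sum_porbits_S (R : comNzRingType) (m : nat) (x : R) :
  \sum_(s : 'S_m.+1) x ^+ #|porbits s| =
  (x + m%:R) * \sum_(s : 'S_m) x ^+ #|porbits s|.
Proof.
pose h (p : 'I_m.+1 * 'S_m) := (tperm ord0 p.1 * lift_perm ord0 ord0 p.2)%g.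
have h_inj : injective h.
  case=> [j s] [k t] /= /permP eqh.
  (* The first component is thus recovered from [h p] as the preimage of [ord0]. *)
  have hE p : h p p.1 = ord0 by rewrite /h permM tpermR lift_perm_id.
  have {}eqh : h (j, s) =1 h (k, t) by [].
  have ejk : j = k.
    by apply: (@perm_inj _ (h (j, s))); rewrite (hE (j, s)) eqh (hE (k, t)).
  rewrite -{k}ejk in eqh *; congr (_, _); apply/permP => y.
  have {eqh}/mulgI/permP/(_ (lift ord0 y)) : h (j, s) = h (j, t) by apply/permP.
  by rewrite !lift_perm_lift => /lift_inj.
have h_bij : bijective h.
  by apply: inj_card_bij h_inj _; rewrite card_prod !card_Sn card_ord factS.
rewrite (reindex h) /=; last exact: onW_bij.
rewrite -(pair_bigA _ (fun j s => x ^+ #|porbits (h (j, s))|)) /=.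
rewrite big_ord_recl /h /= mulrDl mulr_sumr; congr (_ + _).
  by apply: eq_bigr => s _; rewrite tperm1 mul1g card_porbits_lift_perm exprS.
rewrite (eq_bigr (fun=> \sum_(s : 'S_m) x ^+ #|porbits s|)); last first.
  move=> j _; apply: eq_bigr => s _; congr (x ^+ _).
  have := porbits_mul_tperm (lift_perm ord0 ord0 s) ord0 (lift ord0 j).
  rewrite porbit_sym porbit_lift_perm_id inE eq_sym neq_lift.
  by rewrite card_porbits_lift_perm /=; lia.
by rewrite sumr_const card_ord mulr_natl.
Qed.

Lemma sum_porbits (R : comNzRingType) (m : nat) (x : R) :
  \sum_(s : 'S_m) x ^+ #|porbits s| = \prod_(t < m) (x + t%:R).
Proof.
elim: m => [|m IHm]; last by rewrite sum_porbits_S IHm big_ord_recr /= mulrC.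
rewrite big_ord0 (big_pred1 1%g) /=; last first.
  by move=> s; apply/esym/eqP/permP => -[].
have -> : porbits (1%g : 'S_0) = set0; last by rewrite cards0.
by apply/setP => A; rewrite inE; apply/imsetP => -[[]].
Qed.

(** This is [sum_porbits] taken at the element ['X] of the polynomial ring. *)
Lemma coef_rising (R : comNzRingType) (m k : nat) :
  (\prod_(t < m) ('X + t%:R%:P) : {poly R})`_k = (stirling1 m k)%:R.
Proof.
under eq_bigr do rewrite polyC_natr.
rewrite -sum_porbits coef_sum /stirling1.
under eq_bigr do rewrite coefXn eq_sym.
by rewrite -natr_sum -big_mkcond sum1_card cardsE.
Qed.

(* [x (x + 1) ... (x + m)] divided by [x]. *)
Definition rising1 (R : comNzRingType) (m : nat) : {poly R} :=
  \prod_(t < m) ('X - (- t.+1%:R)%:P).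

Lemma coef_rising1 (R : comNzRingType) (m k : nat) :
  (rising1 R m)`_k = (stirling1 m.+1 k.+1)%:R.
Proof.
rewrite -coef_rising big_ord_recl /= addr0 coefXM /=.
by under [in RHS]eq_bigr do rewrite -[X in 'X + X]opprK -polyCN.
Qed.

Lemma rising1_monic (R : comNzRingType) (m : nat) : rising1 R m \is monic.
Proof. exact: monic_prod_XsubC. Qed.

Lemma size_rising1 (R : comNzRingType) (m : nat) : size (rising1 R m) = m.+1.
Proof. by rewrite size_prod_XsubC [index_enum _]unlock -enumT size_enum_ord. Qed.

Lemma rising1_root (R : comNzRingType) (m t : nat) :
  (t < m)%N -> (rising1 R m).[- t.+1%:R] = 0.
Proof.
move=> lttm; rewrite horner_prod (bigD1 (Ordinal lttm)) //=.
by rewrite hornerXsubC subrr mul0r.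
Qed.
(** Entries are indexed by natural numbers, so that sizes can be reassociated and blocks cut out by
    index shifts without casts. *)
Definition detn {R : comPzRingType} (N : nat) (F : nat -> nat -> R) : R :=
  \det (\matrix_(i < N, j < N) F i j).

(** * Block decompositions and row exchanges of determinants *)

Section NatDeterminants.
Context {R : comNzRingType}.
Implicit Types F G : nat -> nat -> R.

Lemma eq_detn N F G :
  (forall i j, (i < N)%N -> (j < N)%N -> F i j = G i j) -> detn N F = detn N G.
Proof. by move=> eqFG; congr (\det _); apply/matrixP => i j; rewrite !mxE eqFG. Qed.

Lemma detnM N F G :
  detn N F * detn N G = detn N (fun i j => \sum_(k < N) F i k * G k j).
Proof.
rewrite /detn -det_mulmx; congr (\det _); apply/matrixP => i j.
by rewrite !mxE; apply: eq_bigr => k _; rewrite !mxE.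
Qed.

Lemma detn_lblock m n F :
  (forall i j, (i < m)%N -> (j < n)%N -> F i (m + j)%N = 0) ->
  detn (m + n) F = detn m F * detn n (fun i j => F (m + i)%N (m + j)%N).
Proof.
move=> F0; rewrite /detn -[X in \det X]submxK.
set B := ursubmx _; have -> : B = 0 by apply/matrixP => i j; rewrite !mxE /= F0.
by rewrite det_lblock; congr (_ * _); congr (\det _);
  apply/matrixP => i j; rewrite !mxE.
Qed.

Lemma detn_ublock m n F :
  (forall i j, (i < n)%N -> (j < m)%N -> F (m + i)%N j = 0) ->
  detn (m + n) F = detn m F * detn n (fun i j => F (m + i)%N (m + j)%N).
Proof.
move=> F0; rewrite /detn -[X in \det X]submxK.
set B := dlsubmx _; have -> : B = 0 by apply/matrixP => i j; rewrite !mxE /= F0.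
by rewrite det_ublock; congr (_ * _); congr (\det _);
  apply/matrixP => i j; rewrite !mxE.
Qed.

Lemma detn_unitrig N F :
  (forall i j, (i < j)%N -> (j < N)%N -> F i j = 0) ->
  (forall i, (i < N)%N -> F i i = 1) -> detn N F = 1.
Proof.
move=> F0 F1; rewrite /detn det_trig.
  by apply: big1 => i _; rewrite mxE F1.
by apply/is_trig_mxP => i j ltij; rewrite mxE F0.
Qed.

Lemma detn1 N : detn N (fun i j => (i == j)%:R) = 1 :> R.
Proof.
apply: detn_unitrig => [i j ltij _|i _]; last by rewrite eqxx.
by rewrite ltn_eqF.
Qed.

(** Induction on [d]: row 0 has its only 1 in column [n], so expanding along it contributes the sign
    [(-1) ^+ n]. *)
Lemma detn_swap d n :
  detn (d + n) (fun i j => ((if i < d then i + n else i - d)%N == j)%:R)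
  = (-1) ^+ (n * d) :> R.
Proof.
elim: d => [|d IHd].
  by rewrite muln0 expr0 -[RHS](detn1 n);
    apply: eq_detn => i j _ _; rewrite ltn0 subn0.
have ltn_dn : (n < (d + n).+1)%N by rewrite ltnS leq_addl.
rewrite /detn addSn (expand_det_row _ ord0) (bigD1 (Ordinal ltn_dn)) //=.
rewrite !mxE eqxx mul1r big1 ?addr0 => [|j]; last first.
  by rewrite !mxE -val_eqE /= eq_sym => /negPf->; rewrite mul0r.
rewrite /cofactor add0n mulnS exprD -IHd; congr (_ * \det _).
apply/matrixP => i j; rewrite !mxE; congr (_%:R : R); rewrite !lift0 /= /bump.
have := ltn_ord i; rewrite /= ltnS subSS => ltidn.
by case: (ltnP i d); case: (leqP n j) => /=; lia.
Qed.

(** Moving the last [d] rows above the [n] rows before them is a left multiplication by a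
    permutation matrix, made of an identity block of size [b] and the matrix of [detn_swap]. *)
Lemma detn_row_swap b d n F :
  detn (b + (d + n))
    (fun i => F (if i < b then i else if i < b + d then i + n else i - d)%N)
  = (-1) ^+ (n * d) * detn (b + (d + n)) F.
Proof.
pose r i := (if i < b then i else if i < b + d then i + n else i - d)%N.
have <- : detn (b + (d + n)) (fun i j => (r i == j)%:R) = (-1) ^+ (n * d) :> R.
  rewrite detn_lblock => [|i j ltib ltj]; last first.
    by rewrite /r ltib; case: eqP => //; lia.
  rewrite -detn_swap -[RHS]mul1r; congr (_ * _); last first.
    apply: eq_detn => i j lti ltj; congr (_%:R : R).
    rewrite /r ltnNge leq_addr ltn_add2l /=.
    by case: (ltnP i d) => lid; lia.
  by rewrite -[RHS](detn1 b); apply: eq_detn => i j ltib _; rewrite /r ltib.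
rewrite detnM; apply: eq_detn => i j lti ltj; rewrite -/(r i).
have ltr : (r i < b + (d + n))%N 
  by rewrite /r; case: (ltnP i b); case: (ltnP i (b + d)); lia.
rewrite (bigD1 (Ordinal ltr)) //= eqxx mul1r big1 ?addr0 // => k.
by rewrite -val_eqE eq_sym /= => /negPf->; rewrite mul0r.
Qed.

End NatDeterminants.

(* Complete the rows [q i] to a basis of the polynomials of degree less than
   b + d + n by the monomials outside the window, and multiply by the matrix
   that evaluates at the [x t] and reads off the top n coefficients. *)
Lemma detn_coef_window (R : comNzRingType) (b d n : nat) (x : nat -> R)
    (q : nat -> {poly R}) :
  (forall i, (i < n)%N -> q i \is monic) ->
  (forall i, (i < n)%N -> size (q i) = (b + d + i).+1) ->
  (forall i t, (i < n)%N -> (t < b + d)%N -> (q i).[x t] = 0) ->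
  detn n (fun i j => (q i)`_(b + j)) * detn (b + d) (fun i j => x j ^+ i) =
  (-1) ^+ (n * d) *
    detn (b + d) (fun i j => x j ^+ (if i < b then i else i + n)%N).
Proof.
move=> q_monic q_size q_root.
pose p i : {poly R} :=
  if (i < b)%N then 'X^i else if (i < b + n)%N then q (i - b)%N else 'X^i.
have size_p i : (i < b + (d + n))%N -> (size (p i) <= b + (d + n))%N.
  rewrite /p => lti; case: (ltnP i b) => [|leib]; first by rewrite size_polyXn; lia.
  case: ltnP => ltin; last by rewrite size_polyXn.
  by rewrite q_size; lia.
(* The monomial rows are unit vectors supported outside the columns of the window, so only the
   window remains. *)
have -> : detn n (fun i j => (q i)`_(b + j)) =
          detn (b + (d + n)) (fun i j => (p i)`_j).
  rewrite [(d + n)%N]addnC detn_lblock => [|i j ltib _]; last first.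
    by rewrite /p ltib coefXn; case: eqP => //; lia.
  rewrite detn_ublock => [|i j ltid ltjn]; last first.
    rewrite /p ltnNge leq_addr /= ltn_add2l ltnNge leq_addr /= coefXn.
    by case: eqP => //; lia.
  rewrite (eq_detn b _ (fun i j => (i == j)%:R)) => [|i j ltib _]; last first.
    by rewrite /p ltib coefXn eq_sym.
  rewrite (eq_detn d _ (fun i j => (i == j)%:R)) => [|i j _ _]; last first.
    rewrite /p ltnNge leq_addr /= ltn_add2l ltnNge leq_addr /= coefXn.
    by rewrite !eqn_add2l eq_sym.
  rewrite !detn1 mul1r mulr1; apply: eq_detn => i j ltin _.
  by rewrite /p ltnNge leq_addr /= ltn_add2l ltin addKn.
pose W k j : R := if (j < b + d)%N then x j ^+ k else (k == j)%:R.
have <- : detn (b + (d + n)) W = detn (b + d) (fun i j => x j ^+ i).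
  rewrite addnA detn_lblock => [|i j ltib ltjn]; last first.
    by rewrite /W ltnNge leq_addr /=; case: eqP => //; lia.
  rewrite -[RHS]mulr1 -[in RHS](detn1 n); congr (_ * _).
    by apply: eq_detn => i j _ ltj; rewrite /W ltj.
  by apply: eq_detn => i j _ _; rewrite /W ltnNge leq_addr eqn_add2l.
(* In the order [r] the monomials come first, with exactly the exponents of the right-hand side, and
   the rows [q i] come last. *)
pose r i := (if i < b then i else if i < b + d then i + n else i - d)%N.
rewrite -[X in X * _](signrMK (n * d)%N) -(detn_row_swap b d n) -/r -mulrA.
congr (_ * _); rewrite detnM.
rewrite (eq_detn _ _ (fun i j =>
    if (j < b + d)%N then (p (r i)).[x j] else (p (r i))`_j)); last first.
  move=> i j lti ltj; rewrite -/(r i) /W; case: ltnP => lejd.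
    rewrite (@horner_coef_wide _ (b + (d + n))) // size_p //.
    by rewrite /r; case: (ltnP i b); case: (ltnP i (b + d)); lia.
  rewrite (bigD1 (Ordinal ltj)) //= eqxx mulr1 big1 ?addr0 // => k.
  by rewrite -val_eqE /= => /negPf->; rewrite mulr0.
have p_r i : (i < n)%N -> p (r (b + d + i)%N) = q i.
  move=> ltin; rewrite /r -addnA ltnNge leq_addr ltn_add2l ltnNge leq_addr /=.
  rewrite (_ : (b + (d + i) - d)%N = (b + i)%N); last lia.
  by rewrite /p ltnNge leq_addr /= ltn_add2l ltin addKn.
(* The rows [q i] vanish at the points; their remaining block is unitriangular, since [q i] is monic
   of degree [b + d + i]. *)
rewrite addnA detn_ublock => [|i j ltin ltj]; last by rewrite ltj p_r ?q_root.
rewrite -[RHS]mulr1; congr (_ * _).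
  apply: eq_detn => i j lti ltj; rewrite ltj /r /p lti.
  case: (ltnP i b) => ltib; first by rewrite ltib hornerXn.
  by rewrite ltnNge (leq_trans ltib) ?leq_addr //= ltnNge leq_add2r ltib hornerXn.
apply: detn_unitrig => [i j ltij ltj|i lti]; rewrite ltnNge leq_addr /= p_r //.
- by rewrite nth_default // q_size //; lia.
- by lia.
- by have /monicP := q_monic i lti; rewrite lead_coefE q_size.
Qed.

(** * Expansion of the generalized Vandermonde determinant *)

Lemma card_ord_ltn (b d : nat) : #|[set i : 'I_(b + d) | (i < b)%N]| = b.
Proof.
rewrite -sum1dep_card big_mkcond big_split_ord /=.
rewrite [X in (_ + X)%N]big1 ?addn0 => [|i _]; last by rewrite ltnNge leq_addr.
by under eq_bigr do rewrite ltn_ord; rewrite sum1_card card_ord.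
Qed.

Lemma detn_shifted_vandermonde (R : comNzRingType) (b d : nat) (x : nat -> R) :
  exists c : {set 'I_(b + d)} -> R, forall n,
    detn (b + d) (fun i j => x j ^+ (if i < b then i else i + n)%N) =
    \sum_(I : {set 'I_(b + d)} | #|I| == b) c I * (\prod_(t in ~: I) x t) ^+ n.
Proof.
pose B := [set i : 'I_(b + d) | (i < b)%N].
(* The point [s i] receives the exponent of row [i], so [s @: B] is the set of points with unshifted
   exponents; [c I] collects the signed terms of these [s] at [n = 0]. *)
exists (fun I => \sum_(s : 'S_(b + d) | s @: B == I)
                   (-1) ^+ s * \prod_i x (s i) ^+ i) => n.
rewrite /detn /determinant (partition_big (fun s : 'S_(b + d) => s @: B)
  (fun I : {set 'I_(b + d)} => #|I| == b)) /= => [|s _]; last first.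
  by rewrite card_imset ?card_ord_ltn //; apply: perm_inj.
apply: eq_bigr => I _; rewrite mulr_suml; apply: eq_bigr => s /eqP <-{I}.
rewrite -mulrA -prodrXl [X in _ * (_ * X)]big_mkcond /=.
rewrite [X in _ * (_ * X)](reindex_inj (@perm_inj _ s)) -big_split /=.
congr (_ * _); apply: eq_bigr => i _.
rewrite mxE in_setC mem_imset; last exact: perm_inj.
by rewrite inE; case: ltnP => _; rewrite ?mulr1 ?exprD.
Qed.

(** * Generating functions of sums of geometric sequences *)

Lemma geometric_convolution (F : fieldType) (r : F) (p : {poly F}) (n : nat) :
  \sum_(i < n.+1) r ^+ i * ((1 - r *: 'X) * p)`_(n - i) = p`_n.
Proof.
have coefE k : ((1 - r *: 'X) * p)`_k = p`_k - r * ('X * p)`_k.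
  by rewrite mulrBl mul1r -scalerAl coefB coefZ.
elim: n => [|n IHn]; first by rewrite big_ord1 coefE coefXM /=; ring.
rewrite big_ord_recl expr0 mul1r subn0 coefE coefXM /=.
rewrite -[in RHS](subrK (r * p`_n) p`_n.+1).
congr (_ + _); rewrite -{}IHn mulr_sumr; apply: eq_bigr => i _.
by rewrite exprS mulrA.
Qed.

Lemma geometric_sum_quotient (F : fieldType) (J : finType) (P : pred J)
    (c r : J -> F) (f : fps F) :
  (forall n, f n = \sum_(j | P j) c j * r j ^+ n) ->
  exists Q, fps_is_quotient f Q (\prod_(j | P j) (1 - r j *: 'X)).
Proof.
move=> fE.
(* The numerator of the sum of the fractions [c j / (1 - r j *: 'X)] over their common
   denominator. *)
exists (\sum_(j | P j) c j *: \prod_(k | P k && (k != j)) (1 - r k *: 'X)).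
split=> [|n].
  rewrite -horner_coef0 horner_prod big1 ?oner_neq0 // => j _.
  by rewrite hornerD hornerN hornerZ hornerX mulr0 subr0 hornerC.
rewrite /fps_mul /fps_of_poly coef_sum.
under [LHS]eq_bigr do rewrite fE mulr_suml.
rewrite exchange_big; apply: eq_bigr => j Pj; rewrite coefZ.
rewrite -(geometric_convolution _ (r j)) mulr_sumr; apply: eq_bigr => i _.
by rewrite (bigD1 j Pj) /= mulrA.
Qed.

(** * Specialization to the points -1, ..., -a *)

Lemma vandermonde_neq0 (F : fieldType) (N : nat) (x : nat -> F) :
  injective x -> detn N (fun i j => x j ^+ i) != 0.
Proof.
move=> x_inj; have := det_Vandermonde (\row_(j < N) x j).
rewrite /Vandermonde /detn; under eq_mx do rewrite mxE; move=> ->.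
apply/prodf_neq0 => i _; apply/prodf_neq0 => j ltij.
by rewrite !mxE subr_eq0 (inj_eq x_inj) gtn_eqF.
Qed.

Lemma fact_ord_prod (a : nat) : a`! = (\prod_(t < a) t.+1)%N.
Proof.
elim: a => [|a IHa]; first by rewrite big_ord0.
by rewrite big_ord_recr /= -IHa factS mulnC.
Qed.

Lemma beta_gfE (a b n : nat) :
  beta_gf a b n = detn n (fun i j => (rising1 rat (a + i))`_(b + j)).
Proof.
rewrite /beta_gf /beta -(det_map_mx intr) /detn; congr (\det _).
by apply/matrixP => i j;
  rewrite !mxE coef_rising1 addSn addSn addnC [(j + b)%N]addnC.
Qed.

Theorem theorem1 (a b : nat) (hba : (b <= a)%N) :
  exists P : {poly rat}, fps_is_quotient (beta_gf a b) P (beta_den a b).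
Proof.
have [d ->] : exists d, a = (b + d)%N by exists (a - b)%N; rewrite subnKC.
pose x t : rat := - t.+1%:R.
pose V := detn (b + d) (fun i j => x j ^+ i).
have V_neq0 : V != 0.
  by apply: vandermonde_neq0 => s t /oppr_inj/eqP; rewrite eqr_nat => /eqP[].
have [c cE] := detn_shifted_vandermonde rat b d x.
apply: (geometric_sum_quotient _ _ _ (fun I => c I / V)) => n.
have window : beta_gf (b + d) b n * V = (-1) ^+ (n * d) *
    detn (b + d) (fun i j => x j ^+ (if i < b then i else i + n)%N).
  pose q i := rising1 rat (b + d + i).
  rewrite beta_gfE (detn_coef_window _ b d n x q) // => [i _|i _|i t _ lttbd].
  - exact: rising1_monic.
  - exact: size_rising1.
  - by rewrite rising1_root // ltn_addr.
rewrite -[LHS](mulfK V_neq0) {}window cE mulr_sumr mulr_suml.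
apply: eq_bigr => I /eqP cardI; rewrite mulrCA -!mulrA; congr (_ * _).
rewrite [RHS]mulrC [in LHS]mulrA; congr (_ / _).
(* The complement of [I] has [d] elements; the [n]-th power of this sign cancels the factor
   [(-1) ^+ (n * d)] of [window]. *)
have -> : \prod_(t in ~: I) x t = (-1) ^+ d * \prod_(t in ~: I) t.+1%:R.
  rewrite prodrN; congr ((-1) ^+ _ * _).
  by rewrite cardsCs setCK card_ord cardI addKn.
rewrite mulnC exprM -exprMn mulrA -expr2 sqrr_sign mul1r; congr (_ ^+ _).
(* The product over the complement is [a!] divided by the product over [I], as in [beta_den]. *)
apply: (canRL (mulfK _)).
  by apply/prodf_neq0 => t _; rewrite pnatr_eq0.
rewrite fact_ord_prod natr_prod [RHS](bigID (mem I)) [LHS]mulrC /=.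
congr (_ * _); by apply: eq_bigl => t; rewrite inE.
Qed.
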